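(* Let $d \in \mathbb{N}$, $d \geq 1$, and let $E$ be a Banach space. Then every semigroup $T : \mathbb{R}_{+}^{d} \to \mathfrak{L}(E)$ which is continuous with respect to the weak operator topology is automatically continuous with respect to the strong operator topology.
   Context: $\mathbb{R}_{+} = [0,\infty)$, and $\mathbb{R}_{+}^{d}$ is viewed as a monoid under pointwise addition, with its usual topology. $\mathfrak{L}(E)$ denotes the bounded linear operators on $E$, $\mathbf{I}$ the identity operator, and $E'$ the continuous dual of $E$. A semigroup $T : \mathbb{R}_{+}^{d} \to \mathfrak{L}(E)$ is a function with $T(0) = \mathbf{I}$ and $T(s+t) = T(s)T(t)$ for all $s,t \in \mathbb{R}_{+}^{d}$. $T$ is continuous with respect to the weak operator topology if $t \mapsto \langle T(t)x, \varphi\rangle$ is continuous for all $x \in E$, $\varphi \in E'$; it is continuous with respect to the strong operator topology if $t \mapsto T(t)x \in E$ is norm-continuous for all $x \in E$. *)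

(* Defs.v *)
From mathcomp Require Import all_boot all_order all_algebra.
From mathcomp Require Import all_classical all_reals all_analysis.

Set Implicit Arguments.
Unset Strict Implicit.
Unset Printing Implicit Defensive.

Import Order.TTheory GRing.Theory Num.Theory.
Import numFieldNormedType.Exports.

Local Open Scope classical_set_scope.
Local Open Scope ring_scope.

Definition orthant (R : realType) (d : nat) : set 'rV[R]_d :=
  [set t | forall i, 0 <= t ord0 i].

Definition bounded_operator (K : numFieldType) (E : normedModType K)
    (A : {linear E -> E}) : Prop :=
  exists M : K, forall x : E, `|A x| <= M * `|x|.

(* A map defined on R_+^d is represented by a total map on R^d. Its values
   outside the orthant are arbitrary: nothing below constrains or uses them,
   and both continuity notions refer to the subspace topology of the orthant. *)
Record semigroup (R : realType) (d : nat) (K : numFieldType)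
    (E : normedModType K) (T : 'rV[R]_d -> {linear E -> E}) : Prop := Semigroup {
  semigroup_bounded : forall t, orthant t -> bounded_operator (T t) ;
  semigroup0 : forall x, T 0 x = x ;
  semigroupD : forall s t, orthant s -> orthant t ->
    forall x, T (s + t) x = T s (T t x) }.

Definition wot_continuous (R : realType) (d : nat) (K : numFieldType)
    (E : normedModType K) (T : 'rV[R]_d -> {linear E -> E}) : Prop :=
  forall (x : E) (phi : {linear E -> K^o}), continuous phi ->
    {within @orthant R d, continuous (fun t => phi (T t x))}.

Definition sot_continuous (R : realType) (d : nat) (K : numFieldType)
    (E : normedModType K) (T : 'rV[R]_d -> {linear E -> E}) : Prop :=
  forall x : E, {within @orthant R d, continuous (fun t => T t x)}.

(* Main.v *)
From HB Require Import structures.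
Require Import Defs.
From mathcomp Require Import all_boot all_order all_algebra.
From mathcomp Require Import complex.
From mathcomp Require Import all_classical all_reals all_analysis.
From mathcomp Require Import ring lra.
Import Order.TTheory GRing.Theory Num.Theory.
Import numFieldNormedType.Exports.
Local Open Scope classical_set_scope.
Local Open Scope ring_scope.

(** The proof replaces the usual weak integrals of orbits by Baire category
and the Hahn-Banach theorem.

Let E be a real Banach space and T weakly continuous. On a box [0, a]^d, which
is compact, each orbit t |-> T t x is weakly bounded, hence norm bounded
([weakly_bounded_bounded]), so the uniform boundedness principle gives
||T t|| <= M on the box ([semigroup_bounded_box]).

By Hahn-Banach, the weak density of rational points in the orthant becomes norm
density of the rational combinations of the vectors T q x, q rational, in the
closed span of the orbit ([rational_combination_dense]). The orbit is thus
covered by countably many small balls. Norm balls are weakly closed, so their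
preimages are closed, and Baire's theorem provides, arbitrarily close to 0, an
open set of times on which the orbit oscillates by at most a given epsilon
([small_oscillation]).

Multiplying by T (s - t) with t a point of that open set, small oscillation near
t is propagated to every s >= t with bounds that do not depend on epsilon; hence
T h y -> y as h -> 0 in the orthant for all y = T (a, ..., a) x with a > 0
([right_continuous0_const]). The set of y with T h y -> y is a closed subspace,
and x is a weak limit of the vectors T (a, ..., a) x, so another use of
Hahn-Banach shows that every x has this property ([right_continuous0_all]).
Strong continuity at t follows by comparing T s x and T t x with T m x, where m
is the coordinatewise minimum of s and t ([wot_sot_real]).

A complex Banach space becomes a real one by restriction of scalars, with the
same topology. A continuous real functional f is the real part of the complex
functional x |-> f x - i f (i x), so weak continuity passes to the real space. *)

Set Implicit Arguments.
Unset Strict Implicit.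
Unset Printing Implicit Defensive.

(** * The Hahn-Banach theorem *)

Section hahn_banach.
Variables (R : realType) (V : lmodType R).
Implicit Types (p q : V -> R) (x y z : V).

Record sublinear p : Prop := Sublinear {
  sublinearD : forall x y, p (x + y) <= p x + p y ;
  sublinearZ : forall c x, 0 < c -> p (c *: x) = c * p x }.

Lemma sublinear0 p : sublinear p -> p 0 = 0.
Proof.
move=> sp; have : p (2 *: 0) = 2 * p 0 by apply: sublinearZ.
by rewrite scaler0; lra.
Qed.

Lemma sublinearN_ge p x : sublinear p -> - p (- x) <= p x.
Proof.
move=> sp; have := sublinearD sp x (- x).
by rewrite subrr sublinear0// -lerBlDr sub0r.
Qed.

(** The standard modification of a sublinear functional in the direction z: it
is sublinear, lies below p, and takes the value - p z at - z, so that p can be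
minimal only if it is additive in the direction z. *)
Definition descent p z x : R :=
  inf [set p (x + t *: z) - t * p z | t in [set t | 0 <= t]].

Section descent_theory.
Variables (p : V -> R) (z : V).
Hypothesis sp : sublinear p.

Lemma descent_lbound x (t : R) : 0 <= t -> - p (- x) <= p (x + t *: z) - t * p z.
Proof.
rewrite le_eqVlt => /predU1P[<-|t0].
  by rewrite scale0r addr0 mul0r subr0 sublinearN_ge.
rewrite -(sublinearZ sp _ t0).
have := sublinearD sp (x + t *: z) (- x).
by rewrite addrAC addrN add0r; lra.
Qed.

Lemma descent_le x (t : R) : 0 <= t -> descent p z x <= p (x + t *: z) - t * p z.
Proof.
move=> t0; apply: ge_inf; last by exists t.
by exists (- p (- x)) => _ [s s0 <-]; exact: descent_lbound.
Qed.

Lemma le_descent x (m : R) : (forall t, 0 <= t -> m <= p (x + t *: z) - t * p z) ->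
  m <= descent p z x.
Proof.
move=> mP; apply: lb_le_inf => [|_ [t t0 <-]]; last exact: mP.
by exists (p (x + 0 *: z) - 0 * p z); exists 0 => //=.
Qed.

Lemma descent_le_self x : descent p z x <= p x.
Proof. by have := @descent_le x 0 (lexx _); rewrite scale0r addr0 mul0r subr0. Qed.

Lemma sublinear_descent : sublinear (descent p z).
Proof.
split=> [x y|c x c0].
- rewrite -lerBlDr; apply: le_descent => t t0.
  rewrite lerBlDr -lerBlDl; apply: le_descent => s s0.
  rewrite lerBlDl.
  apply: (le_trans (descent_le (x + y) (addr_ge0 t0 s0))).
  have := sublinearD sp (x + t *: z) (y + s *: z).
  by rewrite addrACA -scalerDl; lra.
- have dZ (a : R) y : 0 < a -> descent p z (a *: y) <= a * descent p z y.
    move=> a0; rewrite -ler_pdivrMl//; apply: le_descent => t t0.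
    rewrite ler_pdivrMl//.
    have := descent_le (a *: y) (mulr_ge0 (ltW a0) t0).
    by rewrite -scalerA -scalerDr (sublinearZ sp)// mulrBr mulrA.
  apply/eqP; rewrite eq_le dZ//= -ler_pdivlMl//.
  have ci0 : 0 < c^-1 by rewrite invr_gt0.
  by have := dZ c^-1 (c *: x) ci0; rewrite scalerA mulVf ?gt_eqF// scale1r.
Qed.

End descent_theory.

(** Zorn's lemma applies because the pointwise infimum of a chain is again
sublinear: of two members of a chain the smaller one serves both arguments in
the subadditivity inequality, and x |-> - p (- x) is a common lower bound. *)
Lemma minimal_sublinear p : sublinear p ->
  exists q, [/\ sublinear q, forall x, q x <= p x &
    forall r, sublinear r -> (forall x, r x <= q x) -> r = q].
Proof.
move=> sp.
pose T := {q : V -> R | sublinear q /\ forall x, q x <= p x}.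
pose below (q r : T) : bool := `[< forall x, sval r x <= sval q x >].
have t0 : T by exists p; split.
have : exists t, premaximal below t.
  apply: (ZL_preorder t0).
  - by move=> q; apply/asboolP.
  - move=> q r s /asboolP qr /asboolP rs; apply/asboolP => x.
    exact: le_trans (rs x) (qr x).
  move=> A Atot.
  have [[q0 Aq0]|A0] := pselect (exists q : T, A q); last first.
    by exists t0 => s As; exfalso; apply: A0; exists s.
  pose m x := inf [set sval q x | q in A].
  have m_le (q : T) x : A q -> m x <= sval q x.
    move=> Aq; apply: ge_inf; last by exists q.
    exists (- p (- x)) => _ [r Ar <-]; case: r Ar => r [sr rp] Ar /=.
    by apply: le_trans (sublinearN_ge x sr); rewrite lerN2.
  have le_m x c : (forall q : T, A q -> c <= sval q x) -> c <= m x.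
    move=> cP; apply: lb_le_inf; first by exists (sval q0 x), q0.
    by move=> _ [r Ar <-]; exact: cP.
  have sm : sublinear m.
    split=> [x y|c x c0].
    - rewrite -lerBlDr; apply: (le_m _ _) => q Aq.
      rewrite lerBlDr -lerBlDl; apply: (le_m _ _) => r Ar; rewrite lerBlDl.
      have [/asboolP qr|/asboolP rq] := Atot _ _ Aq Ar.
      + apply: (le_trans (m_le _ _ Ar)).
        apply: (le_trans (sublinearD (proj1 (svalP r)) _ _)).
        by rewrite lerD2r; exact: qr.
      + apply: (le_trans (m_le _ _ Aq)).
        apply: (le_trans (sublinearD (proj1 (svalP q)) _ _)).
        by rewrite lerD2l; exact: rq.
    - apply/eqP; rewrite eq_le; apply/andP; split.
      + rewrite -ler_pdivrMl//; apply: (le_m _ _) => q Aq; rewrite ler_pdivrMl//.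
        rewrite -(sublinearZ (proj1 (svalP q)))//; exact: m_le.
      + apply: (le_m _ _) => q Aq; rewrite (sublinearZ (proj1 (svalP q)))//.
        by rewrite ler_pM2l//; exact: m_le.
  have mp x : m x <= p x.
    by apply: le_trans (m_le _ _ Aq0) _; exact: (proj2 (svalP q0)).
  exists (exist _ m (conj sm mp)) => s As; apply/asboolP => x /=; exact: m_le.
move=> [[q [sq qp]] qmax]; exists q; split=> // r sr rq.
have rp x : r x <= p x by exact: le_trans (rq x) (qp x).
have /asboolP /= qr := qmax (exist _ r (conj sr rp)) (asboolT rq).
by apply/funext => x; apply/eqP; rewrite eq_le rq qr.
Qed.

(** A minimal sublinear functional q equals all its descents, so
q x <= q (x + z) - q z for all x and z; with subadditivity, q is additive. *)
Lemma sublinear_dominates_linear p : sublinear p ->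
  exists f : {linear V -> R^o}, forall x, f x <= p x.
Proof.
move=> sp; have [q [sq qp qmin]] := minimal_sublinear sp.
have qD x z : q (x + z) = q x + q z.
  have dE : descent q z = q.
    by apply: qmin; [exact: sublinear_descent|exact: descent_le_self].
  apply/eqP; rewrite eq_le sublinearD//=.
  have := @descent_le q z sq x 1 ler01.
  by rewrite dE scale1r mul1r lerBrDr.
have qN x : q (- x) = - q x.
  by apply/eqP; rewrite -addr_eq0 -qD addNr sublinear0.
have qlin : linear (q : V -> R^o).
  move=> c x y; rewrite qD; congr (_ + _).
  have [c0|c0|->] := ltgtP c 0; last by rewrite !scale0r sublinear0.
  - rewrite -[c]opprK scaleNr qN (sublinearZ sq) ?oppr_gt0//.
    by rewrite [RHS]mulNr.
  - by rewrite (sublinearZ sq).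
pose f : {linear V -> R^o} :=
  HB.pack (q : V -> R^o) (GRing.isLinear.Build _ _ _ _ _ qlin).
by exists f.
Qed.

(** Applying the domination to the descent of p in the direction x0 forces
f (- x0) <= - p x0. *)
Theorem hahn_banach p x0 : sublinear p ->
  exists2 f : {linear V -> R^o}, forall x, f x <= p x & f x0 = p x0.
Proof.
move=> sp; have [f fd] := sublinear_dominates_linear (sublinear_descent x0 sp).
have fp x : f x <= p x by exact: le_trans (fd x) (descent_le_self x0 sp x).
exists f => //; apply/eqP; rewrite eq_le fp /= -lerN2 -linearN.
apply: (le_trans (fd _)); apply: (le_trans (descent_le x0 sp _ ler01)).
by rewrite scale1r addNr sublinear0// mul1r sub0r.
Qed.

End hahn_banach.

(** * Functionals on a normed space *)

Section functionals.
Variables (R : realType) (E : normedModType R).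
Implicit Types (x y : E) (f : {linear E -> R^o}).

Definition contractive f := forall y, `|f y| <= `|y|.

Lemma bounded_functional_continuous f (c : R) :
  (forall y, `|f y| <= c * `|y|) -> continuous f.
Proof.
move=> fc; apply/linear_bounded_continuous/linear_boundedP.
near=> M => y; apply: le_trans (fc y) _; apply: ler_wpM2r => //.
Unshelve. all: by end_near. Qed.

Lemma contractive_continuous f : contractive f -> continuous f.
Proof.
by move=> fc; apply: (@bounded_functional_continuous _ 1) => y; rewrite mul1r.
Qed.

Lemma below_seminorm_contractive (p : E -> R) f :
  (forall y, f y <= p y) -> (forall y, p y <= `|y|) -> contractive f.
Proof.
move=> fp pn y; rewrite ler_norml (le_trans (fp _) (pn _)) andbT lerNl -linearN.
by rewrite -normrN (le_trans (fp _) (pn _)).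
Qed.

Lemma norming_functional x : exists2 f, contractive f & f x = `|x|.
Proof.
have sn : sublinear (fun y : E => `|y|).
  by split=> [y z|c y c0]; [exact: ler_normD|rewrite normrZ gtr0_norm].
have [f fn fx] := hahn_banach x sn.
by exists f => //; exact: below_seminorm_contractive fn _.
Qed.

(** The distance to V is a sublinear functional below the norm which vanishes on
V; a linear functional that it dominates and that agrees with it at x shows
that the distance from x to V is 0. *)
Lemma subspace_separation (V : set E) x :
  V 0 -> (forall u v, V u -> V v -> V (u + v)) ->
  (forall (a : R) v, V v -> V (a *: v)) ->
  (forall f, contractive f -> (forall v, V v -> f v = 0) -> f x = 0) ->
  closure V x.
Proof.
move=> V0 VD VZ fV.
pose p y := inf [set `|y - v| | v in V].
have p_le y v : V v -> p y <= `|y - v|.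
  move=> Vv; apply: ge_inf; last by exists v.
  by exists 0 => _ [w _ <-].
have le_p y c : (forall v, V v -> c <= `|y - v|) -> c <= p y.
  move=> cP; apply: lb_le_inf; first by exists `|y - 0|, 0.
  by move=> _ [v Vv <-]; exact: cP.
have pZ (a : R) y : 0 < a -> p (a *: y) <= a * p y.
  move=> a0; rewrite -ler_pdivrMl//; apply: (le_p _ _) => v Vv.
  rewrite ler_pdivrMl// -{2}(gtr0_norm a0) -normrZ scalerBr.
  exact/p_le/VZ.
have sp : sublinear p.
  split=> [y z|a y a0].
  - rewrite -lerBlDr; apply: (le_p _ _) => v Vv.
    rewrite lerBlDr -lerBlDl; apply: (le_p _ _) => w Vw; rewrite lerBlDl.
    apply: (le_trans (p_le _ _ (VD _ _ Vv Vw))).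
    by rewrite opprD addrACA ler_normD.
  - apply/eqP; rewrite eq_le pZ//= -ler_pdivlMl//.
    have ai0 : 0 < a^-1 by rewrite invr_gt0.
    by have := pZ a^-1 (a *: y) ai0; rewrite scalerA mulVf ?gt_eqF// scale1r.
have [f fp fx] := hahn_banach x sp.
have fc : contractive f.
  by apply: below_seminorm_contractive fp _ => y; rewrite -{2}[y]subr0 p_le.
have pV v : V v -> p v <= 0 by move=> Vv; rewrite -(normr0 E) -(subrr v) p_le.
have f0 v : V v -> f v = 0.
  move=> Vv; apply/eqP; rewrite eq_le (le_trans (fp v) (pV v Vv)) /=.
  rewrite -oppr_le0 -linearN (le_trans (fp _))// pV// -scaleN1r.
  exact: VZ.
have px0 : p x = 0 by rewrite -fx fV.
move=> A /nbhs_ballP[e /= e0 eA].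
apply/not_existsP => nVA.
have : e <= p x.
  apply: (le_p _ _) => v Vv; rewrite leNgt; apply/negP => xv.
  by apply: (nVA v); split => //; apply: eA; rewrite -ball_normE.
by rewrite px0 leNgt e0.
Qed.

End functionals.

(** * Weakly bounded sets are bounded *)

Section uniform_boundedness.
Variable R : realType.

Lemma geometric_small (C e : R) : 0 < e -> exists n : nat, C * 3^-1 ^+ n < e.
Proof.
move=> e0; exists (Num.truncn (C / e)).
set n := Num.truncn _.
have Cn : C < e * n.+1%:R by rewrite mulrC -ltr_pdivrMr// truncnS_gt.
have n3 : n.+1%:R <= 3 ^+ n :> R by rewrite -natrX ler_nat ltn_expl.
rewrite exprVn ltr_pdivrMr ?exprn_gt0//; apply: lt_le_trans Cn _.
by rewrite ler_pM2l.
Qed.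

Lemma zero_of_geometric (C r : R) : (forall n : nat, `|r| <= C * 3^-1 ^+ n) -> r = 0.
Proof.
move=> rC; apply/eqP; rewrite -normr_eq0; apply/eqP/le_anti.
rewrite normr_ge0 andbT leNgt; apply/negP => r0.
by have [n] := geometric_small C r0; rewrite ltNge rC.
Qed.

(** A sequence of functionals that is Cauchy at a geometric rate has a linear
limit with the summed error. As u n - r n increases and u n + r n decreases in
n, where r n is the tail of the geometric series, the supremum of the former can
play the role of the limit. *)
Lemma geometric_approx (V : lmodType R) (u : nat -> {linear V -> R^o}) (N : V -> R) :
  (forall n y, `|u n.+1 y - u n y| <= 3^-1 ^+ n * N y) ->
  exists f : {linear V -> R^o},
    forall n y, `|f y - u n y| <= 3 / 2 * 3^-1 ^+ n * N y.
Proof.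
move=> uN.
pose r n y := 3 / 2 * 3^-1 ^+ n * N y : R.
have tail y n m : `|u (n + m)%N y - u n y| <= r n y - r (n + m)%N y.
  elim: m => [|m IH]; first by rewrite addn0 !subrr normr0.
  rewrite addnS; have -> : r (n + m).+1 y = r (n + m)%N y - 3^-1 ^+ (n + m) * N y.
    by rewrite /r exprS; field.
  have := ler_normD (u (n + m).+1 y - u (n + m)%N y) (u (n + m)%N y - u n y).
  rewrite addrA subrK => /le_trans; apply.
  by have := uN (n + m)%N y; lra.
have r0 n y : 0 <= r n y.
  rewrite /r -mulrA mulr_ge0//; apply: le_trans (uN n y); exact: normr_ge0.
have lu y m n : u m y - r m y <= u n y + r n y.
  have [mn|/ltnW nm] := leqP m n.
    have := tail y m (n - m)%N; rewrite subnKC// ler_norml.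
    by have := r0 n y; lra.
  have := tail y n (m - n)%N; rewrite subnKC// ler_norml.
  by have := r0 m y; lra.
pose f y := sup [set u n y - r n y | n in [set: nat]] : R.
have fu n y : `|f y - u n y| <= r n y.
  rewrite ler_distl; apply/andP; split.
    apply: ub_le_sup; last by exists n.
    by exists (u n y + r n y) => _ [m _ <-]; exact: lu.
  apply: ge_sup; first by exists (u n y - r n y), n.
  by move=> _ [m _ <-]; exact: lu.
have flin : linear (f : V -> R^o).
  move=> a y z; apply/eqP; rewrite -subr_eq0; apply/eqP.
  apply: (@zero_of_geometric (3 / 2 * (N (a *: y + z) + `|a| * N y + N z))) => n.
  have uE : u n (a *: y + z) = a * u n y + u n z :> R by rewrite linearP.
  rewrite [leLHS](_ : _ = `|f (a *: y + z) - (a * f y + f z)|) //.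
  have -> : f (a *: y + z) - (a * f y + f z) =
      (f (a *: y + z) - u n (a *: y + z)) - a * (f y - u n y) - (f z - u n z).
    by rewrite uE; ring.
  apply: (le_trans (ler_normB _ _)); apply: (le_trans (lerD (ler_normB _ _) (lexx _))).
  rewrite normrM.
  have h1 := fu n (a *: y + z); have h3 := fu n z.
  have h2 := ler_wpM2l (normr_ge0 a) (fu n y).
  by apply: (le_trans (lerD (lerD h1 h2) h3)); rewrite /r; lra.
by exists (HB.pack (f : V -> R^o) (GRing.isLinear.Build _ _ _ _ _ flin)
  : {linear V -> R^o}).
Qed.

(** The two values a + b and a - b differ by 2 b. *)
Lemma sign_choice (a b : R) : exists2 s : R, `|s| = 1 & `|b| <= `|a + s * b|.
Proof.
have [h|h] := leP `|b| `|a + b|; first by exists 1; rewrite ?normr1 ?mul1r.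
exists (-1); first by rewrite normrN1.
have := ler_normB (a + b) (a - b).
have -> : a + b - (a - b) = 2 * b by ring.
by rewrite normrM gtr0_norm// mulN1r; lra.
Qed.

(** A gliding hump argument that replaces completeness of the dual space. If S
is unbounded, take x n in S with norm above n * 3 ^ n, a norming functional
psi n of x n, and build u (n + 1) = u n +- 3 ^ (- n) psi n, the sign being chosen
so that |u (n + 1) (x n)| >= 3 ^ (- n) |x n|. All later terms together change the
value at x n by at most half of that, so the limit functional is at least n / 2
in absolute value at x n. *)
Theorem weakly_bounded_bounded (E : normedModType R) (S : set E) :
  (forall f : {linear E -> R^o}, continuous f ->
     exists M, forall x, S x -> `|f x| <= M) ->
  exists M, forall x, S x -> `|x| <= M.
Proof.
move=> Sw; apply/not_existsP => Sunb.
have xP n : exists x, S x /\ n%:R * 3 ^+ n < `|x|.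
  have /existsNP[x /not_implyP[Sx /negP xn]] := Sunb (n%:R * 3 ^+ n).
  by exists x; split => //; rewrite ltNge.
have [x {}xP] := choice xP.
have psiP n : exists f : {linear E -> R^o}, contractive f /\ f (x n) = `|x n|.
  by have [f fc fx] := norming_functional (x n); exists f.
have [psi {}psiP] := choice psiP.
have stepP (nf : nat * {linear E -> R^o}) : exists g : {linear E -> R^o},
    (forall y, `|g y - nf.2 y| <= 3^-1 ^+ nf.1 * `|y|) /\
    3^-1 ^+ nf.1 * `|x nf.1| <= `|g (x nf.1)|.
  case: nf => n f /=.
  have [s s1 sP] := sign_choice (f (x n)) (3^-1 ^+ n * psi n (x n)).
  exists (f \+ (s * 3^-1 ^+ n) \*: psi n)%R; split=> [y|] /=.
    rewrite addrC addKr normrM normrM s1 mul1r ger0_norm ?exprn_ge0//.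
    by rewrite ler_wpM2l ?exprn_ge0//; exact: (psiP n).1.
  move: sP; rewrite (psiP n).2 normrM normr_id ger0_norm ?exprn_ge0//.
  by move=> /le_trans; apply; rewrite mulrA.
have [step {}stepP] := choice stepP.
pose fix u n : {linear E -> R^o} := if n is m.+1 then step (m, u m) else \0%R.
have [f fu] : exists f : {linear E -> R^o},
    forall n y, `|f y - u n y| <= 3 / 2 * 3^-1 ^+ n * `|y|.
  by apply: geometric_approx => n y; exact: (stepP (n, u n)).1.
have fc : continuous f.
  apply: (@bounded_functional_continuous _ _ _ (3 / 2)) => y.
  by have := fu 0%N y; rewrite /= subr0 expr0 mulr1.
have [M fM] := Sw f fc.
have half n : n%:R / 2 <= `|f (x n)|.
  have [Sx xn] := xP n.
  have h1 := (stepP (n, u n)).2; rewrite /= in h1.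
  have h2 := fu n.+1 (x n); rewrite /= distrC in h2.
  have h3 := ler_normD (step (n, u n) (x n) - f (x n)) (f (x n)).
  rewrite subrK in h3.
  have h4 : n%:R < 3^-1 ^+ n * `|x n|.
    by rewrite exprVn mulrC ltr_pdivlMr ?exprn_gt0.
  by move: h2; rewrite exprS; lra.
have := truncnS_gt (2 * M).
have := le_trans (half (Num.truncn (2 * M)).+1) (fM _ (xP _).1).
lra.
Qed.

End uniform_boundedness.

(** * The orthant *)

Section row_norm.
Variables (R : realType) (d : nat).
Implicit Types (s t : 'rV[R]_d).

Lemma row_norm_le t (e : R) : 0 <= e -> (forall i, `|t ord0 i| <= e) -> `|t| <= e.
Proof.
move=> e0 te; rewrite [leLHS]mx_normrE; apply/bigmax_leP; split=> // -[i j] _ /=.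
by rewrite ord1.
Qed.

Lemma coord_le_row_norm t i : `|t ord0 i| <= `|t|.
Proof.
rewrite [leRHS]mx_normrE.
exact: (le_bigmax 0 (fun ij : 'I_1 * 'I_d => `|t ij.1 ij.2|) (ord0, i)).
Qed.

Lemma within_continuous_distP (W : normedModType R) (A : set 'rV[R]_d)
    (f : 'rV[R]_d -> W) :
  {within A, continuous f} <->
  forall t, A t -> forall e, 0 < e -> exists2 r : R, 0 < r &
    forall s, A s -> `|s - t| < r -> `|f s - f t| < e.
Proof.
split=> [/subspace_continuousP fA t At e e0|fA].
  have /cvgrPdist_lt/(_ e e0) := fA t At.
  rewrite near_withinE => /nbhs_ballP[r /= r0 rP]; exists r => // s As st.
  by rewrite distrC; apply: rP => //; rewrite -ball_normE /= distrC.
apply/subspace_continuousP => t At; apply/cvgrPdist_lt => e e0.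
have [r r0 rP] := fA t At e e0.
rewrite near_withinE; apply/nbhs_ballP; exists r => //= s.
by rewrite -ball_normE /= distrC => st As; rewrite distrC; exact: rP.
Qed.

Lemma closed_sublevel (A : set 'rV[R]_d) (g : 'rV[R]_d -> R^o) (c : R) :
  closed A -> {within A, continuous g} -> closed (A `&` [set t | g t <= c]).
Proof.
move=> Acl /within_continuous_distP gA t tcl.
have At : A t by apply: Acl; apply: closureS tcl; exact: subIsetl.
split=> //=; rewrite leNgt; apply/negP => ct.
have e0 : 0 < g t - c by rewrite subr_gt0.
have [r r0 rP] := gA t At _ e0.
have [s [[As /= sc] ts]] := tcl _ (nbhsx_ballx t r r0).
have := rP s As; rewrite -ball_normE /= distrC in ts *.
by move=> /(_ ts); rewrite ltr_norml; lra.
Qed.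

Definition box (a : R) : set 'rV[R]_d := [set t | forall i, 0 <= t ord0 i <= a].

Lemma box_orthant a : box a `<=` @orthant R d.
Proof. by move=> t ta i; have /andP[] := ta i. Qed.

Lemma compact_box a : compact (box a).
Proof.
rewrite (_ : box a = [set t | forall i, `[0, a]%classic (t ord0 i)]).
  by apply: (@rV_compact R d (fun=> `[0, a]%classic)) => _; exact: segment_compact.
by apply/seteqP; split=> t ta i; have := ta i; rewrite /= in_itv.
Qed.

Lemma closed_box a : closed (box a).
Proof. by apply: compact_closed; [exact: norm_hausdorff|exact: compact_box]. Qed.

Lemma orthantD s t : orthant s -> orthant t -> orthant (s + t).
Proof. by move=> s0 t0 i; rewrite mxE addr_ge0. Qed.

Lemma orthant_box t : orthant t -> box `|t| t.
Proof.
by move=> t0 i; rewrite t0/= -(ger0_norm (t0 i)) coord_le_row_norm.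
Qed.

Lemma rat_approx (a e : R) : 0 < e -> exists q : rat, `|ratr q - a| < e.
Proof.
move=> e0; have [|q] := @rat_in_itvoo R (a - e) (a + e); first by lra.
by rewrite in_itv /= => qa; exists q; rewrite ltr_distl.
Qed.

(** Absolute values keep the point in the orthant. *)
Definition rational_point (v : 'rV[rat]_d) : 'rV[R]_d :=
  map_mx (fun q => `|ratr q|) v.

Lemma rational_point_orthant v : orthant (rational_point v).
Proof. by move=> i; rewrite mxE. Qed.

Lemma rational_point_dense t (e : R) : orthant t -> 0 < e ->
  exists v, `|rational_point v - t| < e.
Proof.
move=> t0 e0; have e20 : 0 < e / 2 by rewrite divr_gt0.
have [q qP] := choice (fun i => rat_approx (t ord0 i) e20).
exists (\row_i q i); apply: (@le_lt_trans _ _ (e / 2)); last by lra.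
apply: row_norm_le => [|i]; first exact: ltW.
rewrite !mxE -{1}(ger0_norm (t0 i)).
exact: le_trans (ler_dist_dist _ _) (ltW (qP i)).
Qed.

End row_norm.

(** * Weakly continuous semigroups on a real Banach space *)

HB.instance Definition _ (R : realType) (m n : nat) := Complete.on 'M[R]_(m, n).

Section real_semigroup.
Variables (R : realType) (d : nat) (E : completeNormedModType R).
Variable T : 'rV[R]_d -> {linear E -> E}.
Hypotheses (sT : semigroup T) (wT : wot_continuous T).
Implicit Types (s t h : 'rV[R]_d) (x y : E).

(** The box is compact, so orbits restricted to it are weakly bounded, hence
bounded; the uniform boundedness principle on E then applies to the operators. *)
Lemma semigroup_bounded_box (a : R) :
  exists2 M : R, 0 < M & forall t, box a t -> forall x, `|T t x| <= M * `|x|.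
Proof.
pose F : set (E -> E) := [set (T t : E -> E) | t in box a].
have FP f : F f -> bounded_fun_norm f /\ linear f.
  move=> [t ta <-]; split; last exact: linearP.
  have [M TM] := semigroup_bounded sT (box_orthant ta).
  move=> r; exists (`|M| * `|r|) => x xr; apply: (le_trans (TM x)).
  apply: (@le_trans _ _ (`|M| * `|x|)); first by rewrite ler_wpM2r ?ler_norm.
  by rewrite ler_wpM2l// (le_trans xr)// ler_norm.
have Fpt : pointwise_bounded F.
  move=> x.
  have [M xM] : exists M, forall y, [set T t x | t in box a] y -> `|y| <= M.
    apply: weakly_bounded_bounded => f fc.
    have fTc : {within box a, continuous (fun t => f (T t x) : R^o)}.
      exact: (continuous_subspaceW (@box_orthant R d a) (@wT x _ fc)).
    have [M [_ MP]] := compact_bounded (continuous_compact fTc (@compact_box _ _ a)).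
    exists (M + 1) => _ [t ta <-]; apply: (MP (M + 1)); first by rewrite ltrDl.
    by exists t.
  by exists M => _ [t ta <-]; apply: xM; exists t.
have [M FM] := Banach_Steinhauss FP Fpt 1.
exists (`|M| + 1) => [|t ta x]; first by rewrite ltr_wpDl.
have [->|x0] := eqVneq x 0; first by rewrite linear0 !normr0 mulr0.
have nx : 0 < `|x| by rewrite normr_gt0.
have : `|T t (`|x|^-1 *: x)| <= M.
  apply: FM; first by exists t.
  by rewrite normrZ normfV normr_id mulVf// gt_eqF.
rewrite linearZ normrZ normfV normr_id mulrC ler_pdivrMr// => /le_trans; apply.
by rewrite ler_pM2r//; have := ler_norm M; lra.
Qed.

Definition rational_combination x (c : seq (rat * 'rV[rat]_d)) : E :=
  \sum_(qv <- c) ratr qv.1 *: T (rational_point R qv.2) x.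

(** A functional that vanishes at all T q x with q rational vanishes on the whole
orbit, by weak continuity; so the orbit lies in the norm closed span of these
vectors. Rational coefficients are enough, and make the family countable. *)
Lemma rational_combination_dense x t (e : R) : orthant t -> 0 < e ->
  exists c, `|T t x - rational_combination x c| < e.
Proof.
move=> t0 e0.
pose V : set E := [set v | forall e, 0 < e ->
  exists c, `|v - rational_combination x c| < e].
suff : closure V (T t x).
  have e20 : 0 < e / 2 by rewrite divr_gt0.
  move=> /(_ _ (nbhsx_ballx (T t x) _ e20))[v [Vv]].
  rewrite -ball_normE /= => tv; have [c vc] := Vv _ e20; exists c.
  have := ler_normD (T t x - v) (v - rational_combination x c).
  by rewrite addrA subrK; lra.
apply: subspace_separation.
- by move=> r r0; exists [::]; rewrite /rational_combination big_nil subrr normr0.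
- move=> u v Vu Vv r r0; have r20 : 0 < r / 2 by rewrite divr_gt0.
  have [[b ub] [c vc]] := (Vu _ r20, Vv _ r20); exists (b ++ c).
  rewrite /rational_combination big_cat /= opprD addrACA.
  apply: (le_lt_trans (ler_normD _ _)); rewrite /rational_combination in ub vc; lra.
- move=> a v Vv r r0.
  have a1 : 0 < 2 * (`|a| + 1) by rewrite mulr_gt0// ltr_wpDl.
  have [b vb] := Vv (r / (2 * (`|a| + 1))) (divr_gt0 r0 a1).
  set w := rational_combination x b in vb.
  have w1 : 0 < 2 * (`|w| + 1) by rewrite mulr_gt0// ltr_wpDl.
  have [q qa] := rat_approx a (divr_gt0 r0 w1).
  (* The family is stable under rational scaling only, so a is replaced by q. *)
  exists [seq (q * pv.1, pv.2) | pv <- b].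
  have -> : rational_combination x [seq (q * pv.1, pv.2) | pv <- b] = ratr q *: w.
    rewrite /rational_combination big_map scaler_sumr; apply: eq_bigr => pv _ /=.
    by rewrite rmorphM scalerA.
  have -> : a *: v - ratr q *: w = a *: (v - w) - (ratr q - a) *: w.
    by rewrite scalerBr scalerBl opprB addrA subrK.
  apply: (le_lt_trans (ler_normB _ _)); rewrite !normrZ.
  rewrite ltr_pdivlMr// in vb; rewrite ltr_pdivlMr// in qa.
  have := normr_ge0 (v - w); have := normr_ge0 (ratr q - a).
  by nra.
- move=> f fc fV; apply/eqP; rewrite -normr_eq0; apply/eqP/le_anti.
  rewrite normr_ge0 andbT leNgt; apply/negP => ft0.
  have /within_continuous_distP fT := @wT x _ (contractive_continuous fc).
  have [r r0 rP] := fT t t0 _ ft0.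
  have [v vt] := rational_point_dense t0 r0.
  have fv : f (T (rational_point R v) x) = 0.
    apply: fV => k k0; exists [:: (1, v)].
    by rewrite /rational_combination big_seq1 rmorph1 scale1r subrr normr0.
  have := rP _ (rational_point_orthant R v) vt.
  by rewrite fv sub0r normrN ltxx.
Qed.

(** Countably many closed balls of radius e / 2 cover the orbit. The times in the
box spent in one of them form a closed set, since a norm ball is an intersection
of half-spaces given by continuous functionals; by Baire's theorem one of these
sets has an interior point. *)
Lemma small_oscillation x (a e : R) : 0 < a -> 0 < e ->
  exists2 t, box a t & exists2 r : R, 0 < r &
    forall s, orthant s -> `|s - t| < r -> `|T s x - T t x| <= e.
Proof.
move=> a0 e0.
pose y n : E := if unpickle n is Some c then rational_combination x c else 0.
pose F n : set 'rV[R]_d := \bigcap_(f in @contractive R E)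
  (box a `&` [set t | (f (T t x) : R^o) <= f (y n) + e / 2]).
have Fclosed n : closed (F n).
  apply: closed_bigI => f fc; apply: closed_sublevel; first exact: closed_box.
  apply: (continuous_subspaceW (@box_orthant R d a)).
  exact: (@wT x _ (contractive_continuous fc)).
have FP n t : F n t -> box a t /\ `|T t x - y n| <= e / 2.
  move=> Ft; have [f fc fE] := norming_functional (T t x - y n).
  have [ta /=] := Ft f fc; split => //.
  by rewrite -fE linearB lerBlDl.
have PF n t : box a t -> `|T t x - y n| <= e / 2 -> F n t.
  move=> ta tn f fc; split => //=; rewrite -lerBlDl -linearB.
  exact: le_trans (ler_norm _) (le_trans (fc _) tn).
have [n nF] : exists n, ~ dense (~` F n).
  apply/existsNP => Fdense.
  have := @Baire R 'rV[R]_d (fun n => ~` F n)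
    (fun n => conj (closed_openC (Fclosed n)) (Fdense n)).
  (* The ball of radius a / 2 around this centre lies in the box. *)
  pose c : 'rV[R]_d := const_mx (a / 2).
  have a20 : 0 < a / 2 by rewrite divr_gt0.
  move=> /(_ (ball c (a / 2)) (ex_intro _ c (ballxx c a20)) (ball_open c (a / 2))).
  move=> [t []]; rewrite -ball_normE /= => ct tF.
  have ta : box a t.
    move=> i; have := le_lt_trans (coord_le_row_norm (c - t) i) ct.
    by rewrite !mxE ltr_norml => /andP[h1 h2]; apply/andP; split; lra.
  have e20 : 0 < e / 2 by rewrite divr_gt0.
  have [b tb] := rational_combination_dense x (box_orthant ta) e20.
  apply: (tF (pickle b)) => //; apply: PF => //.
  by rewrite /y pickleK ltW.
have [U [[t [Uo Ut]] UF]] := denseNE nF.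
have UsubF s : U s -> F n s.
  move=> Us; apply: contrapT => nFs.
  by suff : (U `&` ~` F n) s by rewrite UF.
have /nbhs_ballP[r /= r0 rU] := open_nbhs_nbhs (conj Uo Ut).
have [ta tn] := FP _ _ (UsubF t Ut).
exists t => //; exists r => // s _ st.
have /UsubF/FP[_ sn] : U s by apply: rU; rewrite -ball_normE /= distrC.
have := ler_distD (y n) (T s x) (T t x); rewrite (distrC (y n)).
lra.
Qed.

Definition right_continuous0 x := forall e : R, 0 < e -> exists2 r : R, 0 < r &
  forall h, orthant h -> `|h| < r -> `|T h x - x| < e.

(** Write (a, ..., a) = u + t with t a time of small oscillation of the orbit of
x in the box [0, a]^d. Then T h y - y = T u (T (h + t) x - T t x) for
y = T (a, ..., a) x, and the bound on T u is the same for all t in the box. *)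
Lemma right_continuous0_const x (a : R) : 0 < a ->
  right_continuous0 (T (const_mx a) x).
Proof.
move=> a0 e e0; have [M M0 TM] := semigroup_bounded_box a.
have eM : 0 < e / (2 * M) by rewrite divr_gt0// mulr_gt0.
have [t ta [r r0 rP]] := small_oscillation x a0 eM.
exists r => // h h0 hr.
pose u : 'rV[R]_d := const_mx a - t.
have ua : box a u by move=> i; have := ta i; rewrite !mxE; lra.
have ut : const_mx a = u + t by rewrite subrK.
have t0 := box_orthant ta; have u0 := box_orthant ua.
have -> : T h (T (const_mx a) x) - T (const_mx a) x = T u (T (h + t) x - T t x).
  rewrite linearB -(semigroupD sT u0 (orthantD h0 t0)) -(semigroupD sT u0 t0).
  rewrite addrCA -ut -(semigroupD sT h0)// ut; exact: orthantD.
apply: (le_lt_trans (TM u ua _)).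
have : `|T (h + t) x - T t x| <= e / (2 * M).
  by apply: rP; [exact: orthantD|rewrite addrK].
rewrite ler_pdivlMr ?mulr_gt0//; lra.
Qed.

Lemma orthant_norm_box h (r : R) : orthant h -> `|h| < r -> box r h.
Proof.
move=> h0 hr i; have /andP[-> /=] := orthant_box h0 i => /le_trans; apply.
exact: ltW.
Qed.

(** The vectors y with T h y -> y form a subspace, closed because T h is bounded
uniformly in small h. A functional that vanishes on it vanishes at all
T (a, ..., a) x with a > 0, hence at x, by weak continuity at 0. *)
Lemma right_continuous0_all x : right_continuous0 x.
Proof.
have [M M0 TM] := semigroup_bounded_box 1.
have closed_rc y : closure right_continuous0 y -> right_continuous0 y.
  move=> ycl e e0; have eM : 0 < e / (2 * (M + 1)).
    by rewrite divr_gt0// mulr_gt0// addr_gt0.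
  have [v [vrc]] := ycl _ (nbhsx_ballx y _ eM).
  rewrite -ball_normE /= => yv.
  have e20 : 0 < e / 2 by rewrite divr_gt0.
  have [r r0 rP] := vrc _ e20.
  exists (Num.min r 1); first by rewrite lt_min r0 ltr01.
  move=> h h0; rewrite lt_min => /andP[hr h1].
  have -> : T h y - y = T h (y - v) + (T h v - v) - (y - v).
    by rewrite linearB addrA subrK opprB addrA subrK.
  have h2 := TM h (orthant_norm_box h0 h1) (y - v).
  have h3 := rP h h0 hr.
  rewrite ltr_pdivlMr ?mulr_gt0 ?addr_gt0// in yv.
  have h4 := ler_normB (T h (y - v) + (T h v - v)) (y - v).
  have h5 := ler_normD (T h (y - v)) (T h v - v).
  lra.
apply: closed_rc; apply: subspace_separation.
- by move=> e e0; exists 1 => // h _ _; rewrite linear0 subrr normr0.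
- move=> u v urc vrc e e0; have e20 : 0 < e / 2 by rewrite divr_gt0.
  have [[r r0 rP] [q q0 qP]] := (urc _ e20, vrc _ e20).
  exists (Num.min r q); first by rewrite lt_min r0.
  move=> h h0; rewrite lt_min => /andP[hr hq].
  rewrite linearD opprD addrACA; apply: (le_lt_trans (ler_normD _ _)).
  have := rP h h0 hr; have := qP h h0 hq; lra.
- move=> a v vrc e e0; have a1 : 0 < `|a| + 1 by rewrite ltr_wpDl.
  have [r r0 rP] := vrc _ (divr_gt0 e0 a1); exists r => // h h0 hr.
  rewrite linearZ -scalerBr normrZ.
  have := rP h h0 hr; rewrite ltr_pdivlMr//.
  have := normr_ge0 (T h v - v); lra.
- move=> f fc f0; apply/eqP; rewrite -normr_eq0; apply/eqP/le_anti.
  rewrite normr_ge0 andbT leNgt; apply/negP => fx.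
  have /within_continuous_distP fT := @wT x _ (contractive_continuous fc).
  have o0 : orthant (0 : 'rV[R]_d) by move=> i; rewrite mxE.
  have := fT 0 o0; rewrite (semigroup0 sT) => /(_ _ fx)[r r0 rP].
  have r20 : 0 < r / 2 by rewrite divr_gt0.
  have : `|f (T (const_mx (r / 2)) x) - f x| < `|f x|.
    apply: rP; first by move=> i; rewrite mxE ltW.
    rewrite subr0; apply: (@le_lt_trans _ _ (r / 2)); last by lra.
    by apply: row_norm_le => [|i]; [exact: ltW|rewrite mxE gtr0_norm ?lexx].
  by rewrite (f0 _ (@right_continuous0_const x _ r20)) sub0r normrN ltxx.
Qed.

(** The increments T s x - T m x and T t x - T m x equal T m applied to
T h x - x with h = s - m and h = t - m, which lie in the orthant and have norm
at most that of s - t when m is the coordinatewise minimum of s and t. *)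
Theorem wot_sot_real : sot_continuous T.
Proof.
move=> x; apply/within_continuous_distP => t t0 e e0.
have [M M0 TM] := semigroup_bounded_box `|t|.
have eM : 0 < e / (2 * M) by rewrite divr_gt0// mulr_gt0.
have [r r0 rP] := right_continuous0_all x eM.
exists r => // s s0 st.
pose m : 'rV[R]_d := \row_i Num.min (s ord0 i) (t ord0 i).
have m0 : orthant m by move=> i; rewrite mxE le_min s0 t0.
have mt : box `|t| m.
  move=> i; rewrite m0/= mxE.
  have /andP[_] := orthant_box t0 i; apply: le_trans.
  by rewrite ge_min lexx orbT.
have increment u : (u = s \/ u = t) -> `|T u x - T m x| < e / 2.
  move=> us.
  have um : orthant (u - m).
    by move=> i; rewrite !mxE subr_ge0; case: us => ->; rewrite ge_min lexx ?orbT.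
  have umr : `|u - m| < r.
    apply: le_lt_trans st; apply: row_norm_le => // i.
    apply: le_trans (coord_le_row_norm (s - t) i).
    rewrite !mxE; case: us => ->; case: (leP (s ord0 i) (t ord0 i)) => _;
      by rewrite ?subrr ?normr0// distrC.
  have -> : T u x = T m (T (u - m) x) by rewrite -(semigroupD sT)// addrC subrK.
  rewrite -linearB.
  apply: (le_lt_trans (TM m mt _)).
  have := rP _ um umr; rewrite ltr_pdivlMr ?mulr_gt0//; lra.
have := ler_distD (T m x) (T s x) (T t x); rewrite (distrC (T m x)).
have := increment s (or_introl erefl); have := increment t (or_intror erefl).
lra.
Qed.

End real_semigroup.

(** * Restriction of scalars *)

(** A copy of E to carry the structure of a real normed space. The uniform
structure is that of E itself, so that continuity and completeness for E and
for its copy are literally the same statements. *)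
Definition realified (R : realType) (E : normedModType R[i]) : Type := E.

Section realified.
Variables (R : realType) (E : normedModType R[i]).
Local Notation Er := (realified E).

HB.instance Definition _ := GRing.Zmodule.copy Er E.
HB.instance Definition _ := Pointed.copy Er E.
HB.instance Definition _ := Uniform.copy Er E.

Definition rscale (a : R) (x : Er) : Er := (a%:C)%C *: (x : E).

Lemma rscaleA a b v : rscale a (rscale b v) = rscale (a * b) v.
Proof. by rewrite /rscale scalerA rmorphM. Qed.
Lemma rscale1 : left_id 1 rscale.
Proof. by move=> v; rewrite /rscale rmorph1 scale1r. Qed.
Lemma rscaleDr : right_distributive rscale +%R.
Proof. by move=> a u v; rewrite /rscale scalerDr. Qed.
Lemma rscaleDl v : {morph rscale^~ v : a b / a + b}.
Proof. by move=> a b; rewrite /rscale rmorphD scalerDl. Qed.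

HB.instance Definition _ := GRing.Zmodule_isLmodule.Build R Er
  rscaleA rscale1 rscaleDr rscaleDl.

Definition rnorm (x : Er) : R := complex.Re `|x : E|.

Lemma rnormE (x : Er) : (rnorm x)%:C%C = `|x : E|.
Proof. by rewrite /rnorm; apply/RRe_real/normr_real. Qed.

Lemma ler_rnormD x y : rnorm (x + y) <= rnorm x + rnorm y.
Proof. by rewrite -lecR rmorphD /= !rnormE ler_normD. Qed.

Lemma rnorm0_eq0 x : rnorm x = 0 -> x = 0.
Proof. by move=> x0; apply/(@normr0_eq0 _ E); rewrite -rnormE x0. Qed.

Lemma rnormMn x n : rnorm (x *+ n) = rnorm x *+ n.
Proof.
by rewrite /rnorm (_ : `|_ : E| = `|x : E| *+ n) ?raddfMn//; exact: (normrMn (x:E)).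
Qed.

Lemma rnormN x : rnorm (- x) = rnorm x.
Proof. by rewrite /rnorm (_ : `|_ : E| = `|x : E|)//; exact: (normrN (x:E)). Qed.

HB.instance Definition _ := Num.Zmodule_isNormed.Build
  R Er ler_rnormD rnorm0_eq0 rnormMn rnormN.

Lemma rball_entourage :
  entourage = entourage_ (ball_ (fun x : Er => `|x|)).
Proof.
rewrite [LHS](_ : _ = @entourage E)// -entourage_ballE -ball_normE.
apply/seteqP; split => A [e /= e0 eA].
- have e_re : ((complex.Re e)%:C)%C = e by apply/RRe_real/gtr0_real.
  exists (complex.Re e); first by rewrite /= -ltcR e_re.
  by move=> [x y] /= xy; apply: eA; rewrite /= -e_re -rnormE ltcR.
- exists (e%:C)%C; first by rewrite /= ltcR.
  by move=> [x y] /= xy; apply: eA; move: xy; rewrite /= -rnormE ltcR.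
Qed.

HB.instance Definition _ := Uniform_isPseudoMetric.Build R Er
  (@ball_norm_center _ _) (@ball_norm_symmetric _ _) (@ball_norm_triangle _ _)
  rball_entourage.

HB.instance Definition _ := NormedZmod_PseudoMetric_eq.Build R Er erefl.

Lemma rnormZ (a : R) (x : Er) : `|a *: x| = `|a| * `|x|.
Proof.
apply: (@complexI R); rewrite rmorphM /= [LHS]rnormE [X in _ * X]rnormE.
by rewrite [LHS](@normrZ _ E) normc_def /= expr0n addr0 sqrtr_sqr.
Qed.

HB.instance Definition _ :=
  PseudoMetricNormedZmod_Lmodule_isNormedModule.Build R Er rnormZ.

End realified.

HB.instance Definition _ (R : realType) (E : completeNormedModType R[i]) :=
  Complete.copy (realified E) E.

Section complex_reduction.
Variables (R : realType) (E : normedModType R[i]).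
Local Notation Er := (realified E).

Lemma realified_linear (A : {linear E -> E}) : linear (A : Er -> Er).
Proof. by move=> a x y; rewrite -[LHS]/(A (_ *: (x : E) + y)) linearP. Qed.

Definition realified_map (A : {linear E -> E}) : {linear Er -> Er} :=
  HB.pack (A : Er -> Er) (GRing.isLinear.Build _ _ _ _ _ (realified_linear A)).

Lemma realified_bounded (A : {linear E -> E}) :
  bounded_operator A -> bounded_operator (realified_map A).
Proof.
(* The norm of x is real, so only the real part of the inequality matters. *)
move=> [M AM]; exists (complex.Re M) => x.
have := AM x; rewrite -2!rnormE lecE => /andP[_] /=.
by case: M {AM} => a b /=; rewrite mulr0 subr0.
Qed.

Lemma complexify_linear (f : {linear Er -> R^o}) :
  linear (fun x : E => (f x +i* - f ('i%C *: x : E))%C : R[i]^o).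
Proof.
move=> [a b] x y.
have scaleE (z : E) : ((a +i* b)%C *: z : E) =
    (a *: (z : Er) + b *: (('i%C *: z : E) : Er) : Er).
  rewrite [RHS](_ : _ = (a%:C)%C *: z + (b%:C)%C *: ('i%C *: z)) //.
  rewrite scalerA -scalerDl; congr (_ *: _).
  by apply/eqP; rewrite eq_complex /=; apply/andP; split; apply/eqP; ring.
have fE (z w : E) : f (((a +i* b)%C *: z + w) : E) =
    a * f z + b * f ('i%C *: z : E) + f w.
  rewrite scaleE [LHS](raddfD f (_ : Er) (w : Er)) (raddfD f (_ : Er) (_ : Er)).
  by congr (_ + _ + _); exact: linearZ_LR.
rewrite /= scalerDr scalerA mulrC -scalerA !fE scalerA -expr2 sqrCi scaleN1r.
rewrite (raddfN f (x : Er)).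
apply/eqP; rewrite eq_complex /=; apply/andP; split; apply/eqP; ring.
Qed.

Lemma real_complex_continuous : continuous (fun r : R => (r%:C)%C : R[i]^o).
Proof.
move=> r A /nbhs_ballP[e /= e0 eA].
have e_re : ((complex.Re e)%:C)%C = e by apply/RRe_real/gtr0_real.
apply/nbhs_ballP; exists (complex.Re e); first by rewrite /= -ltcR e_re.
move=> s rs; apply: eA; rewrite -ball_normE /ball_ /= -rmorphB /= normc_def /=.
by rewrite expr0n addr0 sqrtr_sqr -e_re ltcR.
Qed.

(** The unique complex linear functional with real part f. *)
Definition complexify (f : {linear Er -> R^o}) : {linear E -> R[i]^o} :=
  HB.pack (fun x : E => (f x +i* - f ('i%C *: x : E))%C : R[i]^o)
    (GRing.isLinear.Build _ _ _ _ _ (complexify_linear f)).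

Lemma complexify_continuous (f : {linear Er -> R^o}) :
  continuous f -> continuous (complexify f).
Proof.
move=> fc x.
have -> : (complexify f : E -> R[i]^o) =
    (fun x => (f x)%:C%C - 'i%C * (f ('i%C *: x : E))%:C%C).
  apply/funext => z /=; apply/eqP.
  by rewrite eq_complex /=; apply/andP; split; apply/eqP; ring.
apply: cvgB.
  apply: (@continuous_comp E R _ f (fun r => r%:C%C : R[i]^o)) => //.
    exact: fc.
  exact: real_complex_continuous.
apply: cvgMl_tmp.
apply: (@continuous_comp E R _ (fun x => f ('i%C *: x : E)) (fun r => r%:C%C : R[i]^o)).
  apply: (@continuous_comp E E _ (fun x => 'i%C *: x) f).
    exact: scaler_continuous.
  exact: fc.
exact: real_complex_continuous.
Qed.

Lemma Re_continuous : continuous (fun z : R[i]^o => complex.Re z : R^o).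
Proof.
move=> z A /nbhs_ballP[e /= e0 eA].
apply/nbhs_ballP; exists (e%:C)%C; first by rewrite /= ltcR.
move=> w zw; apply: eA; move: zw; rewrite -!ball_normE /ball_ /=.
rewrite -raddfB -ltcR; apply: le_lt_trans.
case: (z - w) => a b /=; rewrite normc_def lecR /= -sqrtr_sqr.
by rewrite ler_wsqrtr// lerDl sqr_ge0.
Qed.

End complex_reduction.

Lemma realified_semigroup (R : realType) (d : nat) (E : normedModType R[i])
    (T : 'rV[R]_d -> {linear E -> E}) :
  semigroup T -> semigroup (fun t => realified_map (T t)).
Proof.
by case=> Tb T0 TD; split => // t t0; exact/realified_bounded/Tb.
Qed.

Lemma realified_wot (R : realType) (d : nat) (E : normedModType R[i])
    (T : 'rV[R]_d -> {linear E -> E}) :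
  wot_continuous T -> wot_continuous (fun t => realified_map (T t)).
Proof.
move=> wT x f fc.
have := wT x (complexify f) (complexify_continuous fc) => H t.
apply: (@continuous_comp (subspace (@orthant R d)) _ _
  (fun t => complexify f (T t x)) (fun z => complex.Re z : R^o)).
  exact: H.
exact: Re_continuous.
Qed.

(** * Weak continuity implies strong continuity *)

(* Banach spaces over either scalar field: real (first part), complex (second). *)
Theorem corollary3p2 (R : realType) (d : nat) (hd : (1 <= d)%N) :
  (forall (E : completeNormedModType R) (T : 'rV[R]_d -> {linear E -> E}),
     semigroup T -> wot_continuous T -> sot_continuous T) /\
  (forall (E : completeNormedModType R[i]) (T : 'rV[R]_d -> {linear E -> E}),
     semigroup T -> wot_continuous T -> sot_continuous T).
Proof.
split=> [E T sT wT|E T sT wT]; first exact: wot_sot_real.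
exact: wot_sot_real (realified_semigroup sT) (realified_wot wT).
Qed.
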